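(* Let $\{x,x_1\}$ be a Mannheim $D$-pair of type 1 in Minkowski 3-space $E_1^3$, with $x(s)$ lying on the oriented surface $S$ and $x_1(s_1)$ lying on the oriented surface $S_1$, and let $\theta$ be the angle between the tangent vectors $T$ and $T_1$ at corresponding points. Then the following relations hold at corresponding points: (i) $k_{g_1}=k_n\dfrac{ds}{ds_1}-\dfrac{d\theta}{ds_1}$; (ii) $\tau_g\dfrac{ds}{ds_1}=-k_{n_1}\sinh\theta+\tau_{g_1}\cosh\theta$; (iii) $k_g\dfrac{ds}{ds_1}=-k_{n_1}\cosh\theta+\tau_{g_1}\sinh\theta$; (iv) $\tau_{g_1}=\left(-k_g\sinh\theta+\tau_g\cosh\theta\right)\dfrac{ds}{ds_1}$.
   Context: $E_1^3$ is $\mathbb{R}^3$ with the metric $\langle u,v\rangle=-u_1v_1+u_2v_2+u_3v_3$ and the Lorentzian vector product $u\times v=(u_2v_3-u_3v_2,\;u_1v_3-u_3v_1,\;u_2v_1-u_1v_2)$. All curves and surfaces are smooth. A surface is timelike (spacelike) if its normal vector is spacelike (timelike). Type 1 means: $S$ is a spacelike surface and $x(s)$ is a spacelike curve on it; $S_1$ is a timelike surface and $x_1(s_1)$ is a spacelike curve on it; $s$ and $s_1$ are arc-length parameters. Darboux frames. $\{T,g,n\}$ is the Darboux frame of $x$: $T$ is the unit tangent, $n$ the unit normal of $S$, $g=n\times T$; here $\langle T,T\rangle=\langle g,g\rangle=1$, $\langle n,n\rangle=-1$. The geodesic curvature $k_g$, normal curvature $k_n$ and geodesic torsion $\tau_g$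 of $x$ are defined by $$\frac{dT}{ds}=k_g g+k_n n,\quad \frac{dg}{ds}=-k_gT+\tau_g n,\quad \frac{dn}{ds}=k_nT+\tau_g g.$$ $\{T_1,g_1,n_1\}$ is the Darboux frame of $x_1$ on $S_1$: $T_1$ is the unit tangent, $n_1$ the unit normal of $S_1$, $g_1=n_1\times T_1$; here $\langle T_1,T_1\rangle=1$, $\langle g_1,g_1\rangle=-1$, $\langle n_1,n_1\rangle=1$. The geodesic curvature $k_{g_1}$, normal curvature $k_{n_1}$ and geodesic torsion $\tau_{g_1}$ of $x_1$ are defined by $$\frac{dT_1}{ds_1}=k_{g_1}g_1-k_{n_1}n_1,\quad \frac{dg_1}{ds_1}=k_{g_1}T_1+\tau_{g_1}n_1,\quad \frac{dn_1}{ds_1}=k_{n_1}T_1+\tau_{g_1}g_1.$$ Mannheim $D$-pair. $\{x,x_1\}$ is a Mannheim $D$-pair if there is a smooth regular correspondence $s=s(s_1)$ between the points of the curves such that at corresponding points the frame vector $g$ of $x$ coincides with the frame vector $n_1$ of $x_1$, i.e. $g=n_1$ and $x(s(s_1))=x_1(s_1)+\lambda n_1(s_1)$ with $\lambda$ a nonzero constant. Angle. $\theta=\theta(s_1)$ is the smooth real function with $T=\cosh\theta\,T_1+\sinh\theta\,g_1$ and $n=\sinh\theta\,T_1+\cosh\theta\,g_1$ at corresponding points. *)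

(* Defs.v *)
From HB Require Import structures.
From mathcomp Require Import all_boot all_order all_algebra.
From mathcomp Require Import all_classical all_reals all_analysis.

Set Implicit Arguments.
Unset Strict Implicit.
Unset Printing Implicit Defensive.

Import Order.TTheory GRing.Theory Num.Theory.
Import numFieldNormedType.Exports.

Local Open Scope classical_set_scope.
Local Open Scope ring_scope.

Definition cosh (R : realType) (t : R) : R := (expR t + expR (- t)) / 2.
Definition sinh (R : realType) (t : R) : R := (expR t - expR (- t)) / 2.

(* [Ck k U f] and [smooth U f] are meant for open [U] in a finite-dimensional
   space, where quantifying over all directions [v] amounts to quantifying over
   partial derivatives. *)
Fixpoint Ck (R : realType) (V W : normedModType R) (k : nat)
    (U : set V) (f : V -> W) : Prop :=
  (forall p, U p -> {for p, continuous f}) /\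
  (if k is k'.+1 then
     forall v : V, (forall p, U p -> derivable f p v) /\ Ck k' U ('D_v f)
   else True).

Definition smooth (R : realType) (V W : normedModType R)
    (U : set V) (f : V -> W) : Prop :=
  forall k, Ck k U f.

Section Minkowski.
Variable R : realType.
Local Notation E := 'rV[R]_3.

(* Coordinates are indexed from 0, so the timelike coordinate is [u 0 0]. *)
Definition ldot (u v : E) : R :=
  - (u 0 0 * v 0 0) + u 0 1 * v 0 1 + u 0 2%:R * v 0 2%:R.

Definition lcross (u v : E) : E :=
  \row_(i < 3) [:: u 0 1 * v 0 2%:R - u 0 2%:R * v 0 1;
                   u 0 0 * v 0 2%:R - u 0 2%:R * v 0 0;
                   u 0 1 * v 0 0 - u 0 0 * v 0 1]`_i.

Definition spacelike (v : E) : Prop := v = 0 \/ 0 < ldot v v.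
Definition timelike (v : E) : Prop := ldot v v < 0.
Definition lunit (v : E) : Prop := `|ldot v v| = 1.

(* The third clause says that [X] is an open map into [S] for the subspace
   topology; with injectivity and continuity, [X] is a homeomorphism of [U]
   onto an open subset of [S]. The last one says that the differential of [X]
   is injective. *)
Definition local_parametrization (S : set E) (U : set 'rV[R]_2)
    (X : 'rV[R]_2 -> E) : Prop :=
  [/\ open U /\ smooth U X,
      {in U &, injective X},
      forall U' : set 'rV[R]_2, open U' -> U' `<=` U ->
        exists2 W : set E, open W & X @` U' = S `&` W
    & forall q v : 'rV[R]_2, U q -> 'D_v X q = 0 -> v = 0].

Definition regular_surface (S : set E) : Prop :=
  forall p, S p -> exists U X, local_parametrization S U X /\ (X @` U) p.

Definition tangent_vector (S : set E) (p v : E) : Prop :=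
  exists2 e : R, 0 < e &
  exists c : R -> E,
    [/\ smooth `]- e, e[%classic c, forall t : R, `]- e, e[%classic t -> S (c t),
        c 0 = p & derive1 c 0 = v].

(* Orthogonality is Lorentzian; the values of [N] outside [S] are irrelevant. *)
Definition unit_normal_field (S : set E) (N : E -> E) : Prop :=
  [/\ forall U X, local_parametrization S U X -> smooth U (N \o X),
      forall p, S p -> lunit (N p)
    & forall p v, S p -> tangent_vector S p v -> ldot (N p) v = 0].

Definition oriented_surface (S : set E) (N : E -> E) : Prop :=
  regular_surface S /\ unit_normal_field S N.

Definition spacelike_surface (S : set E) (N : E -> E) : Prop :=
  oriented_surface S N /\ forall p, S p -> timelike (N p).

Definition timelike_surface (S : set E) (N : E -> E) : Prop :=
  oriented_surface S N /\ forall p, S p -> spacelike (N p).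

Definition arclength_curve_on (S : set E) (I : set R) (x : R -> E) : Prop :=
  [/\ open I /\ is_interval I, smooth I x,
      forall s, I s -> S (x s)
    & forall s, I s -> lunit (derive1 x s)].

Definition spacelike_curve (I : set R) (x : R -> E) : Prop :=
  forall s, I s -> spacelike (derive1 x s).

(* The Darboux frame of [x] on the surface oriented by [N]. *)
Definition frameT (x : R -> E) (s : R) : E := derive1 x s.
Definition framen (N : E -> E) (x : R -> E) (s : R) : E := N (x s).
Definition frameg (N : E -> E) (x : R -> E) (s : R) : E :=
  lcross (framen N x s) (frameT x s).

Definition darboux_curvatures_spacelike (N : E -> E) (I : set R) (x : R -> E)
    (kg kn tg : R -> R) : Prop :=
  forall s, I s ->
    let T := frameT x in let g := frameg N x in let n := framen N x in
    [/\ is_derive s 1 T (kg s *: g s + kn s *: n s),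
        is_derive s 1 g (- kg s *: T s + tg s *: n s)
      & is_derive s 1 n (kn s *: T s + tg s *: g s)].

Definition darboux_curvatures_timelike (N : E -> E) (I : set R) (x : R -> E)
    (kg kn tg : R -> R) : Prop :=
  forall s, I s ->
    let T := frameT x in let g := frameg N x in let n := framen N x in
    [/\ is_derive s 1 T (kg s *: g s - kn s *: n s),
        is_derive s 1 g (kg s *: T s + tg s *: n s)
      & is_derive s 1 n (kn s *: T s + tg s *: g s)].

Definition type1 (S : set E) (N : E -> E) (I : set R) (x : R -> E)
    (S1 : set E) (N1 : E -> E) (I1 : set R) (x1 : R -> E) : Prop :=
  [/\ spacelike_surface S N, arclength_curve_on S I x /\ spacelike_curve I x,
      timelike_surface S1 N1
    & arclength_curve_on S1 I1 x1 /\ spacelike_curve I1 x1].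

(* [sigma] is the correspondence s = s(s_1). *)
Definition mannheim_D_pair (N : E -> E) (I : set R) (x : R -> E)
    (N1 : E -> E) (I1 : set R) (x1 : R -> E) (sigma : R -> R) : Prop :=
  [/\ set_bij I1 I sigma, smooth I1 sigma,
      forall s1, I1 s1 -> derive1 sigma s1 != 0
    & exists2 lambda : R, lambda != 0 &
      forall s1, I1 s1 ->
        frameg N x (sigma s1) = framen N1 x1 s1 /\
        x (sigma s1) = x1 s1 + lambda *: framen N1 x1 s1].

Definition mannheim_angle (N : E -> E) (x : R -> E)
    (N1 : E -> E) (I1 : set R) (x1 : R -> E) (sigma theta : R -> R) : Prop :=
  smooth I1 theta /\
  forall s1, I1 s1 ->
    frameT x (sigma s1) = cosh (theta s1) *: frameT x1 s1
                          + sinh (theta s1) *: frameg N1 x1 s1 /\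
    framen N x (sigma s1) = sinh (theta s1) *: frameT x1 s1
                            + cosh (theta s1) *: frameg N1 x1 s1.

End Minkowski.

(* Main.v *)
Require Import Defs.
From HB Require Import structures.
From mathcomp Require Import all_boot all_order all_algebra.
From mathcomp Require Import all_classical all_reals all_analysis.
From mathcomp Require Import ring.

Set Implicit Arguments.
Unset Strict Implicit.
Unset Printing Implicit Defensive.

Import Order.TTheory GRing.Theory Num.Theory.
Import numFieldNormedType.Exports.

Local Open Scope classical_set_scope.
Local Open Scope ring_scope.

(* Differentiate T = cosh(theta) T_1 + sinh(theta) g_1 and
   n = sinh(theta) T_1 + cosh(theta) g_1 along s = sigma(s_1), substitute the
   two Darboux systems, and compare coefficients in the basis (T_1, g_1, n_1),
   using g = n_1.  The T_1- and g_1-components of the first equation give (i),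
   its n_1-component gives (iii), the n_1-component of the second gives (ii),
   and (iv) is the combination of (ii) and (iii) by cosh^2 - sinh^2 = 1. *)

Section MatrixDerivative.
Context {R : realFieldType} {V : normedModType R} {m n : nat}.
Implicit Types M : V -> 'M[R]_(m, n).

(** Passing to entries reduces the product and chain rules for vector-valued maps to the scalar
    ones. *)
Lemma is_derive_mxP M (t v : V) (dM : 'M[R]_(m, n)) :
  is_derive t v M dM <->
  forall i j, is_derive t v (fun x => M x i j) (dM i j).
Proof.
split=> [[dM1 <-] i j|dMij].
  by split; [apply: (derivable_mxP M t v).1|rewrite derive_mx// mxE].
have dM1 : derivable M t v by apply/derivable_mxP => i j; case: (dMij i j).
split=> //; rewrite derive_mx//; apply/matrixP => i j.
by rewrite mxE; case: (dMij i j).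
Qed.

Lemma is_derive_scale_mx (f : V -> R) M (t v : V) (df : R)
    (dM : 'M[R]_(m, n)) :
  is_derive t v f df -> is_derive t v M dM ->
  is_derive t v (fun x => f x *: M x) (df *: M t + f t *: dM).
Proof.
move=> fdf /is_derive_mxP dMij; apply/is_derive_mxP => i j.
have -> : (fun x => (f x *: M x) i j) = f * (fun x => M x i j).
  by apply/funext => x; rewrite mxE.
apply: (is_derive_eq (is_deriveM fdf (dMij i j))).
by rewrite !mxE addrC [df * _]mulrC.
Qed.

End MatrixDerivative.

Lemma is_derive1_comp_mx (R : realType) (m n : nat) (M : R -> 'M[R]_(m, n))
    (f : R -> R) (t df : R) (dM : 'M[R]_(m, n)) :
  is_derive (f t) 1 M dM -> is_derive t 1 f df ->
  is_derive t 1 (M \o f) (df *: dM).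
Proof.
move=> /is_derive_mxP dMij fdf; apply/is_derive_mxP => i j.
by rewrite mxE mulrC; exact: is_derive1_comp (dMij i j) fdf.
Qed.

Lemma smooth_is_derive1 (R : realType) (W : normedModType R) (U : set R)
    (f : R -> W) (t : R) :
  smooth U f -> U t -> is_derive t 1 f (derive1 f t).
Proof.
move=> /(_ 1%N)[_ /(_ 1)[df _]] Ut; rewrite derive1E.
exact/derivableP/df.
Qed.

(** The frame identities hold only on the parameter interval, so derivatives are compared through
    equality near the point. *)
Lemma is_derive_near_unique (R : numFieldType) (V W : normedModType R)
    (f g : V -> W) (t v : V) (df dg : W) :
  (\near t, f t = g t) -> is_derive t v f df -> is_derive t v g dg -> df = dg.
Proof. by move=> fg [_ <-] [_ <-]; exact: near_eq_derive. Qed.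

Section Hyperbolic.
Context {R : realType}.
Implicit Types t : R.

Lemma cosh_gt0 t : 0 < cosh t.
Proof. by rewrite divr_gt0// addr_gt0// expR_gt0. Qed.

Lemma cosh2Bsinh2 t : cosh t ^+ 2 - sinh t ^+ 2 = 1.
Proof.
have e1 : expR t * expR (- t) = 1 by rewrite -expRD subrr expR0.
by rewrite /cosh /sinh -[RHS]e1; field.
Qed.

Lemma is_derive_cosh_comp (f : R -> R) t (df : R) :
  is_derive t 1 f df ->
  is_derive t 1 (fun x => cosh (f x)) (df * sinh (f t)).
Proof.
move=> fdf.
(* In this combinator form the derivative is found by instance resolution. *)
have -> : (fun x => cosh (f x)) = 2^-1 \*: ((expR \o f) + (expR \o - f)).
  by apply/funext => x; rewrite /cosh mulrC.
by apply: is_derive_eq; rewrite /sinh !fctE /GRing.scale/=; field.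
Qed.

Lemma is_derive_sinh_comp (f : R -> R) t (df : R) :
  is_derive t 1 f df ->
  is_derive t 1 (fun x => sinh (f x)) (df * cosh (f t)).
Proof.
move=> fdf.
have -> : (fun x => sinh (f x)) = 2^-1 \*: ((expR \o f) - (expR \o - f)).
  by apply/funext => x; rewrite /sinh mulrC.
by apply: is_derive_eq; rewrite /cosh !fctE /GRing.scale/=; field.
Qed.

End Hyperbolic.

Section Minkowski.
Context {R : realType}.
Implicit Types u v w : 'rV[R]_3.

Lemma ldotC u v : ldot u v = ldot v u.
Proof. by rewrite /ldot; ring. Qed.

Lemma ldotDr u v w : ldot u (v + w) = ldot u v + ldot u w.
Proof. by rewrite /ldot !mxE; ring. Qed.

Lemma ldotZr u (a : R) v : ldot u (a *: v) = a * ldot u v.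
Proof. by rewrite /ldot !mxE; ring. Qed.

Lemma ldot_crossl u v : ldot u (lcross u v) = 0.
Proof. by rewrite /ldot !mxE /=; ring. Qed.

Lemma ldot_crossr u v : ldot v (lcross u v) = 0.
Proof. by rewrite /ldot !mxE /=; ring. Qed.

(** Lorentzian form of Lagrange's identity, with sign opposite to the Euclidean one. *)
Lemma ldot_cross2 u v :
  ldot (lcross u v) (lcross u v) = ldot u v ^+ 2 - ldot u u * ldot v v.
Proof. by rewrite /ldot !mxE /=; ring. Qed.

Lemma lunit_neq0 u : lunit u -> ldot u u != 0.
Proof. by rewrite /lunit => u1; rewrite -normr_eq0 u1 oner_neq0. Qed.

(** The vectors [v], [lcross u v], [u] are mutually orthogonal and none is null, so pairing with
    each of them isolates its coefficient. *)
Lemma lcross_frame_inj u v (a b c a' b' c' : R) :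
  lunit u -> lunit v -> ldot u v = 0 ->
  a *: v + b *: lcross u v + c *: u = a' *: v + b' *: lcross u v + c' *: u ->
  [/\ a = a', b = b' & c = c'].
Proof.
move=> /lunit_neq0 uu /lunit_neq0 vv uv E.
have vu : ldot v u = 0 by rewrite ldotC.
have gg : ldot (lcross u v) (lcross u v) != 0.
  by rewrite ldot_cross2 uv expr0n sub0r oppr_eq0 mulf_neq0.
split; [apply: (mulIf vv)|apply: (mulIf gg)|apply: (mulIf uu)].
- move/(congr1 (ldot v)): E.
  by rewrite !ldotDr !ldotZr ldot_crossr vu !mulr0 !addr0.
- move/(congr1 (ldot (lcross u v))): E; rewrite !ldotDr !ldotZr.
  rewrite (ldotC (lcross u v) v) (ldotC (lcross u v) u).
  by rewrite ldot_crossr ldot_crossl !mulr0 !addr0 !add0r.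
- move/(congr1 (ldot u)): E.
  by rewrite !ldotDr !ldotZr ldot_crossl uv !mulr0 !add0r.
Qed.

End Minkowski.

(** Serves both frame equations: [(u, v)] is $(T_1, g_1)$ for $T$ and $(g_1, T_1)$ for $n$. *)
Lemma is_derive_hyperbolic_comb (R : realType) (n : nat)
    (f : R -> R) (u v : R -> 'rV[R]_n) (t df : R) (du dv : 'rV[R]_n) :
  is_derive t 1 f df -> is_derive t 1 u du -> is_derive t 1 v dv ->
  is_derive t 1 (fun x => cosh (f x) *: u x + sinh (f x) *: v x)
    (df *: (sinh (f t) *: u t + cosh (f t) *: v t)
     + (cosh (f t) *: du + sinh (f t) *: dv)).
Proof.
move=> fdf udu vdv.
have dc := is_derive_scale_mx (is_derive_cosh_comp fdf) udu.
have ds := is_derive_scale_mx (is_derive_sinh_comp fdf) vdv.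
apply: (is_derive_eq (is_deriveD dc ds)).
by rewrite addrACA scalerDr !scalerA.
Qed.

Theorem theorem4p3 (R : realType)
    (S S1 : set 'rV[R]_3) (N N1 : 'rV[R]_3 -> 'rV[R]_3)
    (I I1 : set R) (x x1 : R -> 'rV[R]_3)
    (kg kn tg kg1 kn1 tg1 : R -> R) (sigma theta : R -> R)
    (Htype : type1 S N I x S1 N1 I1 x1)
    (Hcurv : darboux_curvatures_spacelike N I x kg kn tg)
    (Hcurv1 : darboux_curvatures_timelike N1 I1 x1 kg1 kn1 tg1)
    (Hpair : mannheim_D_pair N I x N1 I1 x1 sigma)
    (Hangle : mannheim_angle N x N1 I1 x1 sigma theta)
    (s1 : R) (Hs1 : I1 s1) :
  let s := sigma s1 in
  let ds := derive1 sigma s1 in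
  let th := theta s1 in
  [/\ kg1 s1 = kn s * ds - derive1 theta s1,
      tg s * ds = - kn1 s1 * sinh th + tg1 s1 * cosh th,
      kg s * ds = - kn1 s1 * cosh th + tg1 s1 * sinh th
    & tg1 s1 = (- kg s * sinh th + tg s * cosh th) * ds].
Proof.
move=> s ds th.
have [_ _ [[_ [_ N1unit _]] _] [[[openI1 _] _ x1S x1unit] _]] := Htype.
have [[sigmaI _ _] smsigma _ [lambda _ gn]] := Hpair.
have [smtheta Tn] := Hangle.
have Is : I s by exact: sigmaI.
have dsig : is_derive s1 1 sigma ds := smooth_is_derive1 smsigma Hs1.
have dth := smooth_is_derive1 smtheta Hs1.
have [dT _ dn] := Hcurv _ Is.
have [dT1 dg1 _] := Hcurv1 _ Hs1.
have nearI1 : \forall t \near s1, I1 t by exact: open_nbhs_nbhs.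
have gE : frameg N x s = framen N1 x1 s1 by case: (gn _ Hs1).
have [TE nE] := Tn _ Hs1.
have n1unit : lunit (framen N1 x1 s1) by exact/N1unit/x1S.
have T1unit : lunit (frameT x1 s1) by exact: x1unit.
(* [n_1 = g = n x T] is orthogonal to [T], and [g_1 = n_1 x T_1] to [n_1]. *)
have n1T1 : ldot (framen N1 x1 s1) (frameT x1 s1) = 0.
  have := ldot_crossr (framen N x s) (frameT x s).
  rewrite -/(frameg N x s) gE ldotC TE ldotDr !ldotZr ldot_crossl mulr0 addr0.
  by move/eqP; rewrite mulf_eq0 gt_eqF ?cosh_gt0//= => /eqP.
have nearT : \near s1, (frameT x \o sigma) s1 = cosh (theta s1) *: frameT x1 s1
    + sinh (theta s1) *: frameg N1 x1 s1.
  by apply: filterS nearI1 => t /Tn[].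
(* The summands are swapped so that $\cosh\theta$ comes first, as in [is_derive_hyperbolic_comb]. *)
have nearn : \near s1, (framen N x \o sigma) s1 =
    cosh (theta s1) *: frameg N1 x1 s1 + sinh (theta s1) *: frameT x1 s1.
  by apply: filterS nearI1 => t /Tn[_]; rewrite addrC.
have dTE := is_derive_near_unique nearT (is_derive1_comp_mx dT dsig)
  (is_derive_hyperbolic_comb dth dT1 dg1).
have dnE := is_derive_near_unique nearn (is_derive1_comp_mx dn dsig)
  (is_derive_hyperbolic_comb dth dg1 dT1).
(* Both derivative equations are now expressed in $T_1$, $g_1$, $n_1$ alone. *)
rewrite -/s -/th gE nE in dTE; rewrite -/s -/th gE TE in dnE.
have frame_inj := lcross_frame_inj n1unit T1unit n1T1.
rewrite -/(frameg N1 x1 s1) in frame_inj.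
move: dTE dnE frame_inj; rewrite -/th.
(* Generalizing the frame makes the entries of its vectors atoms for [mxE] and [ring]. *)
move: (frameT x1 s1) (frameg N1 x1 s1) (framen N1 x1 s1) => T1 g1 n1.
move=> dTE dnE frame_inj.
(* Coefficients of $dT/ds_1$ along $T_1$, $g_1$, $n_1$: first by the chain rule on $x$, then by
   differentiating the hyperbolic combination. *)
have [|_ eg en] := frame_inj (ds * kn s * sinh th) (ds * kn s * cosh th)
    (ds * kg s) ((derive1 theta s1 + kg1 s1) * sinh th)
    ((derive1 theta s1 + kg1 s1) * cosh th)
    (- kn1 s1 * cosh th + tg1 s1 * sinh th).
  apply/matrixP => i j; move/matrixP/(_ i j): dTE; rewrite !mxE => dTE.
  by apply: (etrans _ (etrans dTE _)); ring.
(* The same for $dn/ds_1$; only its $n_1$-component is kept. *)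
have [|_ _ en'] := frame_inj (ds * kn s * cosh th) (ds * kn s * sinh th)
    (ds * tg s) ((derive1 theta s1 + kg1 s1) * cosh th)
    ((derive1 theta s1 + kg1 s1) * sinh th)
    (- kn1 s1 * sinh th + tg1 s1 * cosh th).
  apply/matrixP => i j; move/matrixP/(_ i j): dnE; rewrite !mxE => dnE.
  by apply: (etrans _ (etrans dnE _)); ring.
(* The $g_1$-component is the one to divide: $\cosh\theta>0$, whereas $\sinh\theta$ may vanish. *)
have egc : ds * kn s = derive1 theta s1 + kg1 s1.
  by apply: (mulIf (lt0r_neq0 (cosh_gt0 th))).
split.
- by rewrite mulrC egc addrAC subrr add0r.
- by rewrite mulrC en'.
- by rewrite mulrC en.
(* After substituting (ii) and (iii), the $k_{n_1}$ terms cancel and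
   $\tau_{g_1}(\cosh^2\theta-\sinh^2\theta)$ remains. *)
- have -> : (- kg s * sinh th + tg s * cosh th) * ds =
      ds * tg s * cosh th - ds * kg s * sinh th by ring.
  by rewrite en en' -[LHS]mulr1 -(cosh2Bsinh2 th); ring.
Qed.
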